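(* Let $b=\alpha+i\beta$ with $\alpha,\beta\in\mathbb{R}$ and $b\neq -1$, and put $$\nu(\alpha)=\sqrt{-81-14\alpha-\alpha^2+4\sqrt{2(7+\alpha)(29+5\alpha)}}.$$ The fixed point $z=-1$ of $O_b$ satisfies the following statements. (a) The fixed point $z=-1$ is attractive if $$\alpha\in\left(-9-2\sqrt{17},\,-5-2\sqrt{5}\right)\cup\left(-9+2\sqrt{17},\,-5+2\sqrt{5}\right)$$ and $\beta\in(-\nu(\alpha),\nu(\alpha))$. It is a superattractor if $b=-7\pm2\sqrt{10}$. (b) The point $z=-1$ is indifferent if $$\alpha\in\left[-9-2\sqrt{17},\,-5-2\sqrt{5}\right]\cup\left[-9+2\sqrt{17},\,-5+2\sqrt{5}\right]$$ and $\beta=\pm\nu(\alpha)$. (c) The fixed point $z=-1$ is repulsive for any other value of $b\in\mathbb{C}$, $b\ne -1$.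
   Context: For $b\in\mathbb{C}$, $O_b:\widehat{\mathbb{C}}\to\widehat{\mathbb{C}}$ is the rational map (after cancelling common factors) $$O_b(z)=z^4\,\frac{-11-6b+b^2+(-3+2b+b^2)z}{-3+2b+b^2+(-11-6b+b^2)z}.$$ For $b\neq-1$ the point $z=-1$ is a fixed point of $O_b$. A fixed point $z_0$ of a rational map $R$ with multiplier $\lambda=R'(z_0)$ is attractive if $|\lambda|<1$, a superattractor if $\lambda=0$, indifferent if $|\lambda|=1$, and repulsive if $|\lambda|>1$. *)

(* Defs.v *)
From HB Require Import structures.
From mathcomp Require Import all_boot all_order all_algebra.
From mathcomp Require Import all_classical all_reals all_analysis.
From mathcomp Require Import complex.
Import Order.TTheory GRing.Theory Num.Theory.
Import numFieldNormedType.Exports.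

Set Implicit Arguments.
Unset Strict Implicit.
Unset Printing Implicit Defensive.

Local Open Scope ring_scope.
Local Open Scope complex_scope.

(* The Riemann sphere: Some z is the finite point z, None is infinity. *)
Definition sphere (R : realType) : Type := one_point_compactification R[i].

(* The self-map of the sphere defined by the fraction p / q: common factors are
   cancelled first, finite zeros of the reduced denominator go to infinity, and
   the value at infinity is the quotient of the coefficients of degree
   max (deg p) (deg q) of the reduced fraction. *)
Definition rational_map (R : realType) (p q : {poly R[i]}) (z : sphere R) :
    sphere R :=
  let p0 := p %/ gcdp p q in
  let q0 := q %/ gcdp p q in
  match z with
  | Some x => if q0.[x] == 0 then None else Some (p0.[x] / q0.[x])
  | None => let d := (maxn (size p0) (size q0)).-1 in
            if q0`_d == 0 then None else Some (p0`_d / q0`_d)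
  end.

(* z0 is a finite fixed point of f with multiplier lam = f'(z0).  The complex
   derivative is taken in the affine chart; the default value 0 at points
   mapped to infinity is immaterial for f continuous at z0, since f z0 is
   finite. *)
Definition fixed_with_multiplier (R : realType) (f : sphere R -> sphere R)
    (z0 lam : R[i]) : Prop :=
  f (Some z0) = Some z0 /\
  is_derive (z0 : R[i]^o) (1 : R[i]^o)
    (fun z : R[i]^o => odflt 0 (f (Some z)) : R[i]^o) (lam : R[i]^o).

(* `|lam| is an element of R[i] with zero imaginary part. *)
Definition attractive (R : realType) (f : sphere R -> sphere R) (z0 : R[i]) :=
  exists2 lam, fixed_with_multiplier f z0 lam & `|lam| < 1.

Definition superattractor (R : realType) (f : sphere R -> sphere R)
    (z0 : R[i]) :=
  exists2 lam, fixed_with_multiplier f z0 lam & lam = 0.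

Definition indifferent (R : realType) (f : sphere R -> sphere R) (z0 : R[i]) :=
  exists2 lam, fixed_with_multiplier f z0 lam & `|lam| = 1.

Definition repulsive (R : realType) (f : sphere R -> sphere R) (z0 : R[i]) :=
  exists2 lam, fixed_with_multiplier f z0 lam & 1 < `|lam|.

Definition O_map (R : realType) (b : R[i]) : sphere R -> sphere R :=
  let A := - 11 - 6 * b + b ^+ 2 in
  let B := - 3 + 2 * b + b ^+ 2 in
  rational_map ('X^4 * (A%:P + B *: 'X)) (B%:P + A *: 'X).

Definition nu (R : realType) (alpha : R) : R :=
  Num.sqrt (- 81 - 14 * alpha - alpha ^+ 2
            + 4 * Num.sqrt (2 * (7 + alpha) * (29 + 5 * alpha))).

Definition attractive_region (R : realType) (alpha beta : R) : Prop :=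
  ((alpha \in `](- 9 - 2 * Num.sqrt 17), (- 5 - 2 * Num.sqrt 5)[) \/
   (alpha \in `](- 9 + 2 * Num.sqrt 17), (- 5 + 2 * Num.sqrt 5)[)) /\
  beta \in `](- nu alpha), (nu alpha)[.

Definition superattractive_parameter (R : realType) (b : R[i]) : Prop :=
  b = (- 7 + 2 * Num.sqrt 10)%:C \/ b = (- 7 - 2 * Num.sqrt 10)%:C.

Definition indifferent_region (R : realType) (alpha beta : R) : Prop :=
  ((alpha \in `[(- 9 - 2 * Num.sqrt 17), (- 5 - 2 * Num.sqrt 5)]) \/
   (alpha \in `[(- 9 + 2 * Num.sqrt 17), (- 5 + 2 * Num.sqrt 5)])) /\
  (beta = nu alpha \/ beta = - nu alpha).

(* Main.v *)
(* The multiplier of O_b at -1 is (b^2 + 14 b + 9) / (4 (b + 1)).  With s = beta^2,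
   |b^2 + 14 b + 9|^2 - 16 |b + 1|^2 is the quadratic
     s^2 + 2 (alpha^2 + 14 alpha + 81) s
       + (alpha^2 + 10 alpha + 5) (alpha^2 + 18 alpha + 13),
   whose linear coefficient is positive.  It has a root s >= 0 exactly when the
   constant term is <= 0, that is for alpha in the two closed intervals, and
   this root is nu(alpha)^2. *)

Require Import Defs.
From HB Require Import structures.
From mathcomp Require Import all_boot all_order all_algebra.
From mathcomp Require Import all_classical all_reals all_analysis.
From mathcomp Require Import complex.
From mathcomp Require Import ring lra.
Import Order.TTheory GRing.Theory Num.Theory.
Import numFieldNormedType.Exports.
Local Open Scope ring_scope.
Local Open Scope complex_scope.

Set Implicit Arguments.
Unset Strict Implicit.

Lemma is_derive_horner_numField (K : numFieldType) (p : {poly K}) (x : K) :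
  is_derive (x : K^o) (1 : K^o) (horner p : K^o -> K^o) (p^`().[x] : K^o).
Proof.
elim/poly_ind: p => [|p c IHp].
  have -> : (horner 0 : K^o -> K^o) = cst 0.
    by apply/funext => y; rewrite horner0.
  by rewrite derivC horner0; exact: is_derive_cst.
have -> : (horner (p * 'X + c%:P) : K^o -> K^o)
    = (horner p : K^o -> K^o) * (id : K^o -> K^o) + cst c.
  by apply/funext => y; rewrite !hornerE.
apply: is_derive_eq.
by rewrite derivMXaddC !hornerE /GRing.scale /= mulr1 [x * _]mulrC.
Qed.

Lemma is_derive_horner_frac (K : numFieldType) (p q : {poly K}) (x : K) :
  q.[x] != 0 ->
  is_derive (x : K^o) (1 : K^o) (fun z : K^o => p.[z] / q.[z] : K^o)
    ((p^`().[x] * q.[x] - p.[x] * q^`().[x]) / q.[x] ^+ 2 : K^o).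
Proof.
move=> qx0.
have dp := is_derive_horner_numField p x.
have dq := is_derive_horner_numField q x.
have dqV : is_derive (x : K^o) (1 : K^o) (fun z : K^o => (q.[z])^-1 : K^o)
    (- q.[x] ^- 2 *: (q^`().[x] : K^o)).
  apply: DeriveDef; first exact: derivableV.
  by rewrite deriveV // derive_val.
apply: (is_derive_eq (is_deriveM dp dqV)).
by rewrite /GRing.scale /=; field.
Qed.

(* The quotient rule numerator is multiplied by [g ^+ 2] when both polynomials
   are multiplied by [g], so cancelling common factors leaves it unchanged. *)
Lemma rational_map_multiplier (R : realType) (p q : {poly R[i]}) (z0 : R[i]) :
  q.[z0] != 0 -> p.[z0] = z0 * q.[z0] ->
  fixed_with_multiplier (rational_map p q) z0
    ((p^`().[z0] * q.[z0] - p.[z0] * q^`().[z0]) / q.[z0] ^+ 2).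
Proof.
move=> qz0 fixz0; rewrite /fixed_with_multiplier /rational_map /=.
have := divpK (dvdp_gcdl p q); have := divpK (dvdp_gcdr p q).
set g := gcdp p q; set p0 := p %/ g; set q0 := q %/ g => qE pE.
move: qz0 fixz0; rewrite -pE -qE !hornerM mulf_eq0 negb_or => /andP[q00 g0].
rewrite mulrA => /(mulIf g0) p0E; split.
  by rewrite (negbTE q00) p0E mulfK.
(* Where [q0] vanishes, [p0.[z] / q0.[z]] is 0 as well, the inverse of 0 being 0. The plain fraction
   therefore agrees with the default value at every point. *)
have -> : (fun z : R[i]^o => odflt 0
    (if q0.[z] == 0 then None else Some (p0.[z] / q0.[z])) : R[i]^o)
  = (fun z : R[i]^o => p0.[z] / q0.[z] : R[i]^o).
  by apply/funext => z; case: eqP => // -> /=; rewrite invr0 mulr0.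
apply: is_derive_eq; first exact: (@is_derive_horner_frac _ p0 q0).
rewrite !derivM !hornerD !hornerM.
by field; rewrite q00 g0.
Qed.

(** At -1 the denominator is [B - A = 8 * (b + 1)] and the numerator is its opposite, so [b != -1]
    yields both the fixed point and the nonzero denominator of the quotient rule. *)
Lemma O_map_multiplier (R : realType) (b : R[i]) : b != -1 ->
  fixed_with_multiplier (O_map b) (-1)
    ((b ^+ 2 + 14 * b + 9) / (4 * (b + 1))).
Proof.
rewrite -subr_eq0 opprK => b1.
rewrite /O_map.
set A := - 11 - 6 * b + b ^+ 2; set B := - 3 + 2 * b + b ^+ 2.
set p := 'X^4 * _; set q := B%:P + _.
have qE : q.[-1] = 8 * (b + 1) by rewrite /q !hornerE /A /B; ring.
have pE : p.[-1] = - (8 * (b + 1)) by rewrite /p !hornerE /A /B; ring.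
have q'E : q^`().[-1] = A.
  by rewrite /q derivD derivC derivZ derivX !hornerE.
have p'E : p^`().[-1] = - 4 * (A - B) + B.
  rewrite /p derivM derivD derivC derivZ derivX derivXn !hornerE /=.
  by rewrite /A /B; ring.
have b8 : 8 * (b + 1) != 0 by rewrite mulf_neq0 // pnatr_eq0.
have := @rational_map_multiplier R p q (-1).
rewrite qE pE q'E p'E => /(_ b8); rewrite mulN1r => /(_ erefl).
by congr fixed_with_multiplier; rewrite /A /B; field.
Qed.

Lemma normc_sqr (R : realType) (z : R[i]) :
  `|z| ^+ 2 = (complex.Re z ^+ 2 + complex.Im z ^+ 2)%:C.
Proof. by rewrite normc_def -rmorphXn /= sqr_sqrtr ?addr_ge0 ?sqr_ge0. Qed.

(* Equals [16 * `|b + 1| ^+ 2 * (`|lambda| ^+ 2 - 1)] for the multiplier [lambda]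
   at [-1], where [a] is the real part of [b] and [s] the square of its
   imaginary part. *)
Definition excess {R : realType} (a s : R) : R :=
  s ^+ 2 + 2 * (a ^+ 2 + 14 * a + 81) * s
  + (a ^+ 2 + 10 * a + 5) * (a ^+ 2 + 18 * a + 13).

(** The sum is the squared modulus of [b + 1] for [b = a +i* c]; up to the factor 16 it is the
    denominator of the squared modulus of the multiplier. *)
Lemma sqr_dist_gt0 (R : realType) (a c : R) :
  a +i* c != -1 -> 0 < (a + 1) ^+ 2 + c ^+ 2.
Proof.
move=> b1; rewrite lt_neqAle addr_ge0 ?sqr_ge0 // andbT eq_sym.
apply: contra b1; rewrite paddr_eq0 ?sqr_ge0 // !sqrf_eq0 addr_eq0.
by move=> /andP[/eqP-> /eqP->]; rewrite eq_complex /= oppr0 !eqxx.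
Qed.

Lemma multiplier_norm_sqr (R : realType) (a c : R) (b := a +i* c) :
  b != -1 ->
  `|(b ^+ 2 + 14 * b + 9) / (4 * (b + 1))| ^+ 2
  = (1 + excess a (c ^+ 2) / (16 * ((a + 1) ^+ 2 + c ^+ 2)))%:C.
Proof.
move=> /sqr_dist_gt0/lt0r_neq0 d0.
rewrite normrM normfV exprMn exprVn !normc_sqr -fmorphV -rmorphM.
rewrite expr2 /b /=.
congr (_%:C).
rewrite /excess; field.
by rewrite d0 /= !exprMn -mulrDr mulf_neq0 // expf_neq0 // pnatr_eq0.
Qed.

(** Signs are multiplicative, so the position of [x] relative to each root decides the sign of the
    product. *)
Lemma quartic_sg (R : realDomainType) (x l1 l2 l3 l4 : R) :
  l1 < l2 -> l2 < l3 -> l3 < l4 ->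
  let P := (x - l1) * (x - l2) * (x - l3) * (x - l4) in
  (P < 0) = (l1 < x < l2) || (l3 < x < l4) /\
  (P <= 0) = (l1 <= x <= l2) || (l3 <= x <= l4).
Proof.
move=> l12 l23 l34 /=.
rewrite -sgr_lt0 -[(_ <= 0 as X in _ /\ X = _)]sgr_le0 !sgrM.
have sgB l : Num.sg (x - l) = if x < l then -1 else if l < x then 1 else 0.
  case: ltgtP => [xl|lx|->]; last by rewrite subrr sgr0.
    by rewrite ltr0_sg // subr_lt0.
  by rewrite gtr0_sg // subr_gt0.
rewrite !sgB.
case: (ltgtP x l1) => h1; case: (ltgtP x l2) => h2;
  case: (ltgtP x l3) => h3; case: (ltgtP x l4) => h4 //=; lra.
Qed.

Section Excess.
Variable R : realType.
Implicit Types a c s : R.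

(** The roots [- 5 -+ 2 * Num.sqrt 5] of the first quadratic interlace with the roots
    [- 9 -+ 2 * Num.sqrt 17] of the second. *)
Lemma excess_const_sg a :
  ((a ^+ 2 + 10 * a + 5) * (a ^+ 2 + 18 * a + 13) < 0) =
   (- 9 - 2 * Num.sqrt 17 < a < - 5 - 2 * Num.sqrt 5)
   || (- 9 + 2 * Num.sqrt 17 < a < - 5 + 2 * Num.sqrt 5) /\
  ((a ^+ 2 + 10 * a + 5) * (a ^+ 2 + 18 * a + 13) <= 0) =
   (- 9 - 2 * Num.sqrt 17 <= a <= - 5 - 2 * Num.sqrt 5)
   || (- 9 + 2 * Num.sqrt 17 <= a <= - 5 + 2 * Num.sqrt 5).
Proof.
have s5 : Num.sqrt 5 ^+ 2 = 5 :> R by rewrite sqr_sqrtr.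
have s17 : Num.sqrt 17 ^+ 2 = 17 :> R by rewrite sqr_sqrtr.
have s5ge0 : 0 <= Num.sqrt 5 :> R := sqrtr_ge0 _.
have s17ge0 : 0 <= Num.sqrt 17 :> R := sqrtr_ge0 _.
have -> : (a ^+ 2 + 10 * a + 5) * (a ^+ 2 + 18 * a + 13)
  = (a - (- 9 - 2 * Num.sqrt 17)) * (a - (- 5 - 2 * Num.sqrt 5))
    * (a - (- 9 + 2 * Num.sqrt 17)) * (a - (- 5 + 2 * Num.sqrt 5)).
  by ring: s5 s17.
(* The tight case is the order of the two largest roots, which amounts to
   [Num.sqrt 17 - Num.sqrt 5 < 2]; the bounds 21/5 and 11/5 differ by exactly 2. *)
have [s5_lo s5_hi] : 11 / 5 < Num.sqrt 5 :> R /\ Num.sqrt 5 < 5 / 2 :> R.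
  by split; rewrite -(@ltr_pXn2r _ 2) ?nnegrE //; lra.
have [s17_lo s17_hi] : 4 < Num.sqrt 17 :> R /\ Num.sqrt 17 < 21 / 5 :> R.
  by split; rewrite -(@ltr_pXn2r _ 2) ?nnegrE //; lra.
by apply: quartic_sg; lra.
Qed.

Lemma excess_coef_gt0 a : 0 < a ^+ 2 + 14 * a + 81.
Proof. by have := sqr_ge0 (a + 7); lra. Qed.

(** With [M] half the linear coefficient and [N] the constant term, [M ^+ 2 - N = 16 * D], so the
    roots in [s] are [- M + 4 * Num.sqrt D = E] and [- M - 4 * Num.sqrt D]. From [N <= 0] follow
    [0 <= D] and [M <= 4 * Num.sqrt D], so neither square root takes its default value. *)
Lemma excess_root a (E := - 81 - 14 * a - a ^+ 2
                      + 4 * Num.sqrt (2 * (7 + a) * (29 + 5 * a))) :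
  (a ^+ 2 + 10 * a + 5) * (a ^+ 2 + 18 * a + 13) <= 0 ->
  0 <= E /\
  forall s, excess a s = (s - E) * (s + E + 2 * (a ^+ 2 + 14 * a + 81)).
Proof.
rewrite /E; set D := 2 * _ * _; set M := a ^+ 2 + 14 * a + 81.
set N := _ * _ => N0.
have M0 : 0 < M := excess_coef_gt0 a.
have DE : 16 * D = M ^+ 2 - N by rewrite /D /M /N; ring.
have M2 : 0 <= M ^+ 2 := sqr_ge0 _.
have D0 : 0 <= D by lra.
have sD := sqr_sqrtr D0.
have sD0 := sqrtr_ge0 D.
split.
  suff : M <= 4 * Num.sqrt D by rewrite /M; lra.
  have D4 : 0 <= 4 * Num.sqrt D by rewrite mulr_ge0.
  by rewrite -(@ler_pXn2r _ 2) ?nnegrE ?(ltW M0) // exprMn sD; lra.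
move=> s; rewrite /excess -/M -/N.
have -> : N = M ^+ 2 - 16 * Num.sqrt D ^+ 2 by rewrite sD DE; ring.
by rewrite /M; ring.
Qed.

Lemma excess_gt0 a s : 0 <= s ->
  0 < (a ^+ 2 + 10 * a + 5) * (a ^+ 2 + 18 * a + 13) -> 0 < excess a s.
Proof.
move=> s0 N0; rewrite /excess ltr_wpDl // addr_ge0 ?sqr_ge0 // mulr_ge0 //.
by rewrite pmulr_rge0 // ltW // excess_coef_gt0.
Qed.

(** When the constant term is nonpositive, [excess] has the sign of [c ^+ 2 - nu a ^+ 2], because
    the other factor in [excess_root] is positive. *)
Lemma attractive_regionE a c :
  attractive_region a c <-> excess a (c ^+ 2) < 0.
Proof.
have [ltN leN] := excess_const_sg a.
have regE : attractive_region a c <->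
    (a ^+ 2 + 10 * a + 5) * (a ^+ 2 + 18 * a + 13) < 0 /\ `|c| < nu a.
  rewrite ltN /attractive_region !in_itv /= ltr_norml.
  by split=> -[/orP].
have M0 := excess_coef_gt0 a.
have c2 := sqr_ge0 c.
split.
  move=> /regE[N0]; have [E0 ->] := excess_root (ltW N0).
  rewrite -(@ltr_pXn2r _ 2) ?nnegrE ?sqrtr_ge0 // /nu sqr_sqrtr //.
  rewrite real_normK ?num_real // => cE.
  by rewrite nmulr_rlt0; lra.
move=> e0; apply/regE.
(* The terms containing [c ^+ 2] are nonnegative, so the constant term is at most [excess]. *)
have N0 : (a ^+ 2 + 10 * a + 5) * (a ^+ 2 + 18 * a + 13) < 0.
  apply: le_lt_trans e0; rewrite /excess lerDr.
  by rewrite addr_ge0 ?sqr_ge0 // mulr_ge0 // pmulr_rge0 // ltW.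
split=> //; have [E0 exE] := excess_root (ltW N0).
rewrite -(@ltr_pXn2r _ 2) ?nnegrE ?sqrtr_ge0 // /nu sqr_sqrtr //.
rewrite real_normK ?num_real // -subr_lt0.
by move: e0; rewrite exE pmulr_llt0 //; lra.
Qed.

(** The two signs before [nu a] merge into [c ^+ 2 = nu a ^+ 2]. Conversely, a positive constant
    term would make [excess] positive. *)
Lemma indifferent_regionE a c :
  indifferent_region a c <-> excess a (c ^+ 2) = 0.
Proof.
have [ltN leN] := excess_const_sg a.
have regE : indifferent_region a c <->
    (a ^+ 2 + 10 * a + 5) * (a ^+ 2 + 18 * a + 13) <= 0 /\ c ^+ 2 = nu a ^+ 2.
  rewrite leN /indifferent_region !in_itv /=.
  split=> -[/orP aI].
    by case=> ->; rewrite ?sqrrN.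
  by move/eqP; rewrite eqf_sqr => /orP[] /eqP; split=> //; [left|right].
have M0 := excess_coef_gt0 a.
split.
  move=> /regE[N0]; have [E0 ->] := excess_root N0.
  by rewrite /nu sqr_sqrtr // => ->; rewrite subrr mul0r.
move=> e0; apply/regE.
have N0 : (a ^+ 2 + 10 * a + 5) * (a ^+ 2 + 18 * a + 13) <= 0.
  rewrite leNgt; apply/negP => /(excess_gt0 (sqr_ge0 c)).
  by rewrite e0 ltxx.
split=> //; have [E0 exE] := excess_root N0.
rewrite /nu sqr_sqrtr //; apply/eqP.
move/eqP: e0; rewrite exE mulf_eq0 subr_eq0 => /orP[//|].
by have := sqr_ge0 c => c0 /eqP; lra.
Qed.
End Excess.

Unset Implicit Arguments.
Set Strict Implicit.

Theorem proposition3 (R : realType) (alpha beta : R) (b : R[i])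
    (hb : b = alpha +i* beta) (hb1 : b <> -1) :
  [/\ attractive_region alpha beta -> attractive (O_map b) (-1),
      superattractive_parameter b -> superattractor (O_map b) (-1),
      indifferent_region alpha beta -> indifferent (O_map b) (-1) &
      ~ attractive_region alpha beta -> ~ superattractive_parameter b ->
      ~ indifferent_region alpha beta -> repulsive (O_map b) (-1)].
Proof.
have b1 : b != -1 by apply/eqP.
have mult := O_map_multiplier b1.
set lam := _ / _ in mult.
have lamE : `|lam| ^+ 2
    = (1 + excess alpha (beta ^+ 2)
         / (16 * ((alpha + 1) ^+ 2 + beta ^+ 2)))%:C.
  by rewrite /lam hb multiplier_norm_sqr // -hb.
have d0 : 0 < 16 * ((alpha + 1) ^+ 2 + beta ^+ 2).
  by rewrite mulr_gt0 // sqr_dist_gt0 // -hb.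
split.
- move=> /attractive_regionE e0; exists lam => //.
  (* Once squared, both sides are embedded reals, and [ltcR] moves the comparison from [R[i]] to
     [R]. *)
  rewrite -(@ltr_pXn2r _ 2) ?nnegrE // lamE expr1n -[X in _ < X]/(1%:C) ltcR.
  by rewrite gtrDl pmulr_llt0 ?invr_gt0.
- move=> bE; exists lam => //; rewrite /lam.
  (* The two parameters [- 7 +- 2 * Num.sqrt 10] are the roots of the numerator of the
     multiplier. *)
  suff -> : b ^+ 2 + 14 * b + 9 = 0 by rewrite mul0r.
  have s10 : Num.sqrt 10 ^+ 2 = 10 :> R by rewrite sqr_sqrtr.
  have toR (x : R) : x%:C ^+ 2 + 14 * x%:C + 9 = (x ^+ 2 + 14 * x + 9)%:C.
    by rewrite !(rmorphD, rmorphM, rmorphXn, rmorph_nat).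
  by case: bE => ->; rewrite toR; congr (_%:C); ring: s10.
- move=> /indifferent_regionE e0; exists lam => //.
  by apply/eqP; rewrite -(@eqrXn2 _ 2) // lamE e0 mul0r addr0 expr1n.
- move=> natt _ nind; exists lam => //.
  rewrite -(@ltr_pXn2r _ 2) ?nnegrE // lamE expr1n -[X in X < _]/(1%:C) ltcR.
  rewrite ltrDl divr_gt0 //.
  (* Trichotomy for [excess]: negative is the attractive region and zero the indifferent one, which
     leaves positive. *)
  by case: ltgtP => // [/attractive_regionE|/esym/indifferent_regionE].
Qed.
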